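(* Let $\nu\geq 2$ be an integer, let $P\in\mathbb{C}[x]$ with $\deg P=n>1$, and let $Q\in\mathbb{C}[x_1,\dotsc,x_\nu]$ with $\deg Q\geq 1$. Suppose that $$P\big(Q(x_1,\dotsc,x_\nu)\big)=Q\big(P(x_1),\dotsc,P(x_\nu)\big)$$ and that $Q\notin\mathbb{C}[x_i]$ for every $i\in\{1,\dotsc,\nu\}$ (that is, $Q$ is not a polynomial in a single one of the variables). Then there exist an affine bijection $\lambda\in\mathbf{Aff}$, a constant $c\in\mathbb{C}$ and a nonzero multi-index $\alpha\in\mathbb{Z}_{\geq 0}^\nu$ such that $$C_\lambda(P)(x)=x^n,\qquad C_\lambda(Q)(x_1,\dotsc,x_\nu)=c\,x^\alpha,\qquad c^{n-1}=1.$$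
   Context: $\mathbf{Aff}$ denotes the group of affine bijections $\mathbb{C}\to\mathbb{C}$, $z\mapsto az+b$, with $a,b\in\mathbb{C}$, $a\neq 0$. For $\lambda\in\mathbf{Aff}$ and a polynomial $R\in\mathbb{C}[z_1,\dotsc,z_k]$ (any $k\geq 1$), the conjugate polynomial is $C_\lambda(R)(z_1,\dotsc,z_k)=\lambda\big(R(\lambda^{-1}(z_1),\dotsc,\lambda^{-1}(z_k))\big)$. For a multi-index $\alpha=(\alpha_1,\dotsc,\alpha_\nu)\in\mathbb{Z}_{\geq 0}^\nu$, $x^\alpha:=x_1^{\alpha_1}\cdots x_\nu^{\alpha_\nu}$. *)

(* Defs.v *)
From HB Require Import structures.
From mathcomp Require Import all_boot all_order all_algebra.
From mathcomp Require Import mpoly.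
From mathcomp Require Import complex reals.

Set Implicit Arguments.
Unset Strict Implicit.
Unset Printing Implicit Defensive.

Import GRing.Theory.
Local Open Scope ring_scope.

Record aff (F : fieldType) : Type := Aff {
  aff_slope : F;
  aff_shift : F;
  aff_slope_neq0 : aff_slope != 0
}.

(* The map z |-> slope * z + shift, with z in any F-algebra A.  A = F^o gives
   the bijection of F itself; A = {poly F} or {mpoly F[k]} gives the polynomial
   obtained by applying the map to (the values of) a polynomial. *)
Definition aff_app (F : fieldType) (l : aff F) (A : algType F) (z : A) : A :=
  aff_slope l *: z + (aff_shift l)%:A.

Definition aff_inv (F : fieldType) (l : aff F) : aff F :=
  @Aff F (aff_slope l)^-1 (- ((aff_slope l)^-1 * aff_shift l))
    (etrans (congr1 negb (invr_eq0 (aff_slope l))) (aff_slope_neq0 l)).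

Lemma aff_appK (F : fieldType) (l : aff F) (A : algType F) :
  cancel (@aff_app F l A) (@aff_app F (aff_inv l) A).
Proof.
move=> z; rewrite /aff_app /= scalerDr !scalerA mulVf ?aff_slope_neq0 //.
by rewrite scale1r scaleNr addrK.
Qed.

Lemma aff_invK (F : fieldType) (l : aff F) (A : algType F) :
  cancel (@aff_app F (aff_inv l) A) (@aff_app F l A).
Proof.
move=> z; rewrite /aff_app /= scalerDr !scalerA mulrN mulVKf ?aff_slope_neq0 //.
by rewrite mulfV ?aff_slope_neq0 // scale1r scaleNr addrNK.
Qed.

Definition conj_poly (F : fieldType) (l : aff F) (P : {poly F}) : {poly F} :=
  aff_app l (P \Po aff_app (aff_inv l) 'X).

Definition conj_mpoly (F : fieldType) (k : nat) (l : aff F)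
    (Q : {mpoly F[k]}) : {mpoly F[k]} :=
  aff_app l (Q \mPo [tuple aff_app (aff_inv l) 'X_i | i < k]).

Lemma horner_conj_poly (F : fieldType) (l : aff F) (P : {poly F}) (z : F) :
  (conj_poly l P).[z]
  = aff_app l (P.[aff_app (aff_inv l) (z : F^o)] : F^o).
Proof.
by rewrite /conj_poly /aff_app !(hornerE, horner_comp) /GRing.scale /= !mulr1.
Qed.

Lemma meval_conj_mpoly (F : fieldType) (k : nat) (l : aff F)
    (Q : {mpoly F[k]}) (v : 'I_k -> F) :
  (conj_mpoly l Q).@[v]
  = aff_app l (Q.@[fun i => aff_app (aff_inv l) (v i : F^o)] : F^o).
Proof.
rewrite /conj_mpoly /aff_app mevalD !mevalZ meval1 comp_mpoly_meval.
congr (_ * _ + _); apply: meval_eq => i.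
by rewrite tnth_mktuple mevalD !mevalZ meval1 mevalXU.
Qed.

(* P(q) for a univariate P and a multivariate q *)
Definition subst_poly (F : fieldType) (k : nat) (P : {poly F})
    (q : {mpoly F[k]}) : {mpoly F[k]} :=
  (map_poly (@mpolyC k F) P).[q].

Definition univariate_in (F : fieldType) (k : nat) (i : 'I_k)
    (Q : {mpoly F[k]}) : Prop :=
  exists p : {poly F}, Q = subst_poly p 'X_i.

(* Main.v *)
Require Import Defs.
From HB Require Import structures.
From mathcomp Require Import all_boot all_order all_algebra.
From mathcomp Require Import mpoly.
From mathcomp Require Import complex reals.
From mathcomp Require Import zify.

Set Implicit Arguments.
Unset Strict Implicit.
Unset Printing Implicit Defensive.

Import GRing.Theory.
Local Open Scope ring_scope.
Local Open Scope complex_scope.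

(* Single out a variable x_i on which Q depends and write
   Q = q x_i^d + (lower terms in x_i).  For given q and d >= 1 at most one such
   Q satisfies P(Q) = Q(P(x_1), ..., P(x_nu)) (semiconj_unique).  If q is
   constant, Q may thus be compared with its specialization at a fixed point of
   P in all the other variables, which shows that Q involves x_i only.
   Otherwise leading coefficients give b q^n = q(P(x_1), ..., P(x_nu)), an
   equation of the same form with b x^n for the outer P, and descending on
   the degree yields a nonconstant univariate f with b f^n = f(P).
   Then P permutes the finitely many roots of f, each being fully ramified,
   which forces P = a (x - z)^n + z.  After conjugation P = x^n, and the same
   uniqueness statement gives Q = q x_i^d, so Q is a monomial by induction. *)

(** * Uniqueness of semiconjugacies of given degree and leading coefficient *)

(* The difference D of two solutions divides P0(F) - P0(G) with a cofactor of
   degree (n - 1) deg F, whereas (map_poly s D) \Po P has degree at most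
   n deg D; this is absurd since deg D < deg F. *)
Lemma semiconj_unique (A : idomainType) (s : {rmorphism A -> A}) (n : nat)
    (P0 P F G : {poly A}) :
    (1 < n)%N -> n%:R != 0 :> A -> size P0 = n.+1 -> size P = n.+1 ->
    (1 < size F)%N -> size G = size F -> lead_coef G = lead_coef F ->
    P0 \Po F = map_poly s F \Po P -> P0 \Po G = map_poly s G \Po P ->
  F = G.
Proof.
move=> n_gt1 nA0 szP0 szP szF szG lcG eqF eqG.
apply/eqP; rewrite -subr_eq0; apply/negPn/negP => D0.
set D : {poly A} := F - G in D0; set d := (size F).-1.
have szFd : size F = d.+1 by rewrite /d prednK // ltnW.
have F0 : F != 0 by rewrite -size_poly_gt0 szFd.
(* [W k] is the cofactor in [F^k - G^k = (F - G) W k]. *)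
pose W k : {poly A} := \sum_(i < k) F ^+ (k.-1 - i) * G ^+ i.
pose S : {poly A} := \sum_(k < n.+1) P0`_k *: W k.
have eqDS : (P0 \Po F) - (P0 \Po G) = D * S.
  rewrite !comp_polyE szP0 -sumrB /S big_distrr /=; apply: eq_bigr => k _.
  by rewrite -scalerBr subrXX scalerAr.
have szX k i : (i < k)%N ->
    size (F ^+ (k.-1 - i) * G ^+ i) = (k.-1 * d).+1.
  move=> ik; have G0 : G != 0 by rewrite -size_poly_gt0 szG szFd.
  have szpow (H : {poly A}) m : H != 0 -> size H = d.+1 ->
      size (H ^+ m) = (m * d).+1.
    move=> H0 szH; rewrite -[LHS]prednK ?size_poly_gt0 ?expf_neq0 //.
    by rewrite size_exp szH mulnC.
  rewrite size_mul ?expf_neq0 // !szpow ?szG // addSn addnS -mulnDl.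
  by rewrite subnK //; case: k ik.
(* Only [k = n] reaches degree [(n - 1) d]; its [n] terms share one leading coefficient, so the sum
   survives because [n] is nonzero in [A]. *)
have cS : S`_(n.-1 * d) = P0`_n * (lead_coef F ^+ n.-1 *+ n).
  rewrite /S coef_sum big_ord_recr /= big1 ?add0r => [|k _]; last first.
    rewrite coefZ coef_sum big1 ?mulr0 // => i _.
    rewrite nth_default // szX // ltn_pmul2r; last by rewrite -ltnS -szFd.
    by move: (ltn_ord k) (leq_ltn_trans (leq0n i) (ltn_ord i)); clear; lia.
  rewrite coefZ coef_sum; congr (_ * _).
  rewrite (eq_bigr (fun=> lead_coef F ^+ n.-1)) ?sumr_const ?card_ord // => i _.
  have -> : (n.-1 * d)%N = (size (F ^+ (n.-1 - i) * G ^+ i)).-1 by rewrite szX.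
  rewrite -/(lead_coef _) lead_coefM !lead_coef_exp lcG -exprD subnK //.
  by move: (ltn_ord i); clear; lia.
have cS0 : S`_(n.-1 * d) != 0.
  rewrite cS mulf_neq0 //; last first.
    by rewrite -mulr_natr mulf_neq0 // expf_neq0 // lead_coef_eq0.
  by rewrite -[n]/(n.+1.-1) -szP0 -/(lead_coef P0) lead_coef_eq0 -size_poly_gt0 szP0.
have szS : (n.-1 * d < size S)%N.
  by rewrite ltnNge; apply/negP => le; rewrite nth_default ?eqxx in cS0.
have S0 : S != 0 by rewrite -size_poly_gt0 (leq_trans _ szS).
have szD : (size D < size F)%N.
  rewrite szFd ltnS; apply/leq_sizeP => j; rewrite leq_eqVlt => /predU1P[<-|dj].
    rewrite coefB /d -{2}szG -/(lead_coef _) -/(lead_coef _) lcG subrr //.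
  by rewrite coefB !nth_default ?subrr // ?szG szFd.
(* [s] may lower degrees, so only an upper bound is available. It gives
   [deg D + (n - 1) d <= n deg D], hence [d <= deg D]. *)
have le : (size (D * S)%R <= (size D).-1 * n + 1)%N.
  rewrite -eqDS eqF eqG -comp_polyB -rmorphB -/D.
  apply: leq_trans (size_comp_poly_leq _ _) _; rewrite szP addn1 ltnS leq_mul //=.
  by rewrite -!subn1 leq_sub2r // size_poly.
move: le szS szD; rewrite size_mul // szFd.
have := D0; rewrite -size_poly_gt0; case: (size D) => // e _ /=.
by move: (size S) n_gt1; clear; case: n => [|[|n]] // ? _; nia.
Qed.

(** * The univariate equation [b f^n = f(P)] *)

Lemma poly_full_fiber (F : closedFieldType) (p : {poly F}) (y : F) :
  p != 0 -> (forall x, root p x -> x = y) ->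
  p = lead_coef p *: ('X - y%:P) ^+ (size p).-1.
Proof.
move=> p0 py; have [r pE] := closed_field_poly_normal p.
have lc0 : lead_coef p != 0 by rewrite lead_coef_eq0.
have rE : r = nseq (size r) y.
  apply/all_pred1P/allP => x xr; apply/eqP/py.
  by rewrite pE rootZ // root_prod_XsubC.
have prE : \prod_(z <- r) ('X - z%:P) = ('X - y%:P) ^+ size r.
  by rewrite rE big_nseq -Monoid.iteropE size_nseq.
have -> : (size p).-1 = size r.
  by rewrite {1}pE size_scale // size_prod_XsubC.
by rewrite {1}pE prE.
Qed.

Lemma semiconj_power (F : closedFieldType) (n : nat) (b : F) (f P : {poly F}) :
    [pchar F] =i pred0 -> (1 < n)%N -> size P = n.+1 -> b != 0 ->
    (1 < size f)%N -> b *: f ^+ n = f \Po P ->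
  exists2 z, root f z & P = lead_coef P *: ('X - z%:P) ^+ n + z%:P.
Proof.
move=> charF n_gt1 szP b0 szf eqf.
have f0 : f != 0 by rewrite -size_poly_gt0 ltnW.
have P0 : P != 0 by rewrite -size_poly_gt0 szP.
have fP x : root f P.[x] = root f x.
  rewrite -[LHS]/(f.[P.[x]] == 0) -horner_comp -eqf hornerZ horner_exp.
  by rewrite mulf_eq0 (negPf b0) expf_eq0 (ltnW n_gt1).
have szPC (z : F) : (size (- z%:P) < size P)%N.
  by rewrite size_polyN szP ltnS (leq_trans (size_polyC_leq1 _)) // ltnW.
have szPz z : size (P - z%:P) = n.+1 by rewrite size_polyDl ?szPC.
have lcPz z : lead_coef (P - z%:P) = lead_coef P by rewrite lead_coefDl ?szPC.
have Psurj z : exists x, P.[x] = z.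
  have /closed_rootP[x] : size (P - z%:P) != 1%N by rewrite szPz eqSS -lt0n ltnW.
  by rewrite /root !hornerE subr_eq0 => /eqP; exists x.
have [r fE] := closed_field_poly_normal f.
have rP x : (x \in r) = root f x.
  by rewrite fE rootZ ?lead_coef_eq0 // root_prod_XsubC.
pose s := undup r; have sP x : (x \in s) = root f x by rewrite mem_undup.
(* [P] is onto and preimages of roots of [f] are roots, so [s] lies in [P(s)]. As [P(s)] has no more
   terms than [s], it has no repetition: [P] is injective on [s]. *)
have s_sub : {subset s <= map (horner P) s}.
  move=> z; rewrite sP => fz; have [x Px] := Psurj z.
  by apply/mapP; exists x => //; rewrite sP -fP Px.
have /(leq_size_uniq (undup_uniq r)) := s_sub; rewrite size_map.
move=> /(_ (leqnn _)) uniqPs.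
have Pinj x y : x \in s -> y \in s -> P.[x] = P.[y] -> x = y.
  move=> xs ys Pxy; rewrite -(nth_index 0 xs) -(nth_index 0 ys); congr nth.
  apply/eqP; rewrite -(nth_uniq 0 _ _ uniqPs) ?size_map ?index_mem //.
  by rewrite !(nth_map 0) ?index_mem // !nth_index ?Pxy.
have fiber z : z \in s -> exists2 y, y \in s &
    P - z%:P = lead_coef P *: ('X - y%:P) ^+ n.
  move=> zs; have [y Py] := Psurj z.
  have ys : y \in s by rewrite sP -fP Py -sP.
  have nE : n = (size (P - z%:P)).-1 by rewrite szPz.
  exists y => //; rewrite -(lcPz z) [n in _ ^+ n]nE.
  apply: poly_full_fiber => [|x]; first by rewrite -size_poly_gt0 szPz.
  rewrite /root !hornerE subr_eq0 => /eqP Px.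
  by apply: Pinj; rewrite ?Py // sP -fP Px -sP.
have /closed_rootP[z fz] : size f != 1%N by rewrite neq_ltn szf orbT.
(* The points [y] over [z] and [x] over [y] are both zeros of [P'], which has a single zero in
   characteristic 0. So [x = y], and comparing the two expansions of [P] gives [z = y]. *)
have [y ys Pz] := fiber z (etrans (sP z) fz).
have [x xs Py] := fiber y ys.
have dP u w : P - w%:P = lead_coef P *: ('X - u%:P) ^+ n ->
    P^`() = lead_coef P *: (('X - u%:P) ^+ n.-1 *+ n).
  move=> /(congr1 deriv); rewrite derivB derivC subr0 => ->.
  by rewrite derivZ deriv_exp derivXsubC mul1r.
have xy : x = y.
  have /(congr1 (horner^~ y)) := dP _ _ Pz; rewrite (dP _ _ Py).
  rewrite !(hornerZ, hornerMn, horner_exp, hornerXsubC) subrr expr0n.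
  have -> : (n.-1 == 0)%N = false by move: n_gt1; clear; lia.
  rewrite mul0rn mulr0 => /eqP; rewrite mulf_eq0 lead_coef_eq0 (negPf P0) /=.
  rewrite -mulr_natr mulf_eq0 ((pcharf0P F).1 charF) expf_eq0 subr_eq0.
  by case: (n) n_gt1 => // m _; rewrite orbF => /andP[_ /eqP].
have zy : z = y.
  by apply/polyC_inj/oppr_inj/(addrI P); rewrite Pz Py xy.
by exists z => //; apply/eqP; rewrite -subr_eq Pz zy.
Qed.

(** * Polynomials in one singled-out variable *)

Lemma mpoly_rmorph_ext (k : nat) (R S : comNzRingType)
    (f g : {rmorphism {mpoly R[k]} -> S}) :
    (forall c, f c%:MP = g c%:MP) -> (forall i, f 'X_i = g 'X_i) ->
  f =1 g.
Proof.
move=> fgC fgX q; rewrite [q]mpolyE !rmorph_sum; apply: eq_bigr => m _.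
rewrite -mul_mpolyC !rmorphM fgC; congr (_ * _).
rewrite mpolyXE_id !rmorph_prod; apply: eq_bigr => i _.
by rewrite !rmorphXn fgX.
Qed.

Section SingleOut.
Variables (F : fieldType) (k : nat).
Implicit Types (P f : {poly F}) (Q q : {mpoly F[k]}) (i : 'I_k).

(** The right-hand side of the equation, as a ring morphism so that it can also act on the
    coefficients of a polynomial over [{mpoly F[k]}]. *)
Definition diag_subst P : {mpoly F[k]} -> {mpoly F[k]} :=
  comp_mpoly [tuple subst_poly P 'X_i | i < k].

HB.instance Definition _ P := GRing.RMorphism.copy (diag_subst P) (diag_subst P).

Lemma diag_substC P c : diag_subst P c%:MP = c%:MP.
Proof. exact: comp_mpolyC. Qed.

Lemma diag_substX P i : diag_subst P 'X_i = subst_poly P 'X_i.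
Proof. by rewrite /diag_subst comp_mpolyXU -tnth_nth tnth_mktuple. Qed.

(* [Q] as a polynomial in ['X_i]; the coefficients stay in [{mpoly F[k]}], but
   do not involve ['X_i]. *)
Definition single_out i : {mpoly F[k]} -> {poly {mpoly F[k]}} :=
  mmap (polyC \o @mpolyC k F) (fun j => if j == i then 'X else ('X_j)%:P).

HB.instance Definition _ i := GRing.RMorphism.copy (single_out i) (single_out i).

Lemma single_outC i c : single_out i c%:MP = (c%:MP)%:P.
Proof. exact: mmapC. Qed.

Lemma single_outX i j :
  single_out i 'X_j = if j == i then 'X else ('X_j)%:P.
Proof. by rewrite /single_out mmapX mmap1U. Qed.

Lemma horner_single_out i Q : (single_out i Q).['X_i] = Q.
Proof.
pose f := horner_eval ('X_i : {mpoly F[k]}) \o single_out i.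
apply: (mpoly_rmorph_ext (f := f) (g := idfun)) => [c|j] /=.
  by rewrite /f /= /horner_eval single_outC hornerC.
rewrite /f /= /horner_eval single_outX; case: eqP => [->|_].
  by rewrite hornerX.
by rewrite hornerC.
Qed.

Lemma rmorph_subst_poly (S : comNzRingType) (f : {rmorphism {mpoly F[k]} -> S})
    P q :
  f (subst_poly P q) = (map_poly (f \o @mpolyC k F) P).[f q].
Proof. by rewrite /subst_poly -horner_map -map_poly_comp. Qed.

Lemma single_out_subst i P Q :
  single_out i (subst_poly P Q) = map_poly (@mpolyC k F) P \Po single_out i Q.
Proof.
rewrite rmorph_subst_poly /comp_poly -map_poly_comp; congr _.[_].
by apply: eq_map_poly => c /=; rewrite single_outC.
Qed.

(** The substitution splits: in ['X_i] it is composition with [P], in the other variables it acts on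
    coefficients. This is the shape required by [semiconj_unique], with [s := diag_subst P]. *)
Lemma single_out_diag i P Q :
  single_out i (diag_subst P Q) =
  map_poly (diag_subst P) (single_out i Q) \Po map_poly (@mpolyC k F) P.
Proof.
pose f := single_out i \o diag_subst P.
pose g := comp_poly (map_poly (@mpolyC k F) P) \o
  (map_poly (diag_subst P) \o single_out i).
apply: (mpoly_rmorph_ext (f := f) (g := g)) => [c|j]; rewrite /f /g /=.
  by rewrite diag_substC !single_outC map_polyC /= diag_substC comp_polyC.
rewrite diag_substX single_out_subst !single_outX.
case: eqP => _; first by rewrite map_polyX comp_polyX comp_polyXr.
by rewrite map_polyC /= comp_polyC diag_substX /comp_poly /subst_poly horner_map.
Qed.

Lemma coef_single_out i Q j :
  (single_out i Q)`_j =
  \sum_(m <- msupp Q | m i == j) Q@_m *: 'X_[(m - U_(i) *+ j)%MM].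
Proof.
rewrite /single_out /mmap coef_sum [RHS]big_mkcond /=; apply: eq_bigr => m _.
rewrite coefCM /mmap1 (bigD1 i) //= eqxx.
have -> : \prod_(l < k | l != i) (if l == i then 'X else ('X_l)%:P) ^+ m l =
    (\prod_(l < k | l != i) 'X_l ^+ m l)%:P :> {poly {mpoly F[k]}}.
  by rewrite rmorph_prod; apply: eq_bigr => l /negPf ->; rewrite rmorphXn.
rewrite coefMC coefXn [j == _]eq_sym.
case: eqP => [mij|_]; last by rewrite mul0r mulr0.
rewrite mul1r mul_mpolyC mpolyXE_id; congr (_ *: _).
rewrite [RHS](bigD1 i) //= mnmBE mulmnE mnm1E eqxx mul1n mij subnn expr0 mul1r.
apply: eq_bigr => l /negPf li.
by rewrite mnmBE mulmnE mnm1E eq_sym li mul0n subn0.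
Qed.

(** Makes the descents terminate: the monomials of this coefficient are monomials of [Q] divided by
    ['X_i ^+ j]. *)
Lemma msize_coef_single_out i Q j :
  (0 < j)%N -> (1 < msize Q)%N -> (msize (single_out i Q)`_j < msize Q)%N.
Proof.
move=> j0 Q1; rewrite coef_single_out -[X in (_ < X)%N]prednK ?(ltnW Q1) // ltnS.
apply: leq_trans (msize_sum _ _ _) _; rewrite big_seq_cond.
elim/big_ind: _ => // [x y xQ yQ|m /andP[mQ /eqP mij]]; first by rewrite geq_max xQ.
apply: leq_trans (msizeZ_le _ _) _; rewrite msizeX.
have Um : (U_(i) *+ j <= m)%MM.
  by apply/mnm_lepP => l; rewrite mulmnE mnm1E; case: eqP => [<-|] //=; rewrite mul1n mij.
have := msize_mdeg_lt mQ; rewrite -{1}(submK Um) mdegD mdegMn mdeg1 mul1n.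
by move: j0; clear; lia.
Qed.

Lemma single_out_nonconst Q :
  (1 < msize Q)%N -> exists i, (1 < size (single_out i Q))%N.
Proof.
move=> Q1; have [/existsP //|/existsPn szQ] :=
  boolP [exists i, (1 < size (single_out i Q))%N].
suff Q0 : Q = (Q@_0)%:MP by move: Q1; rewrite Q0 msizeC; case: eqP.
apply: msize1_polyC; rewrite msizeE; apply/bigmax_leqP_seq => m mQ _.
rewrite ltnS leqn0 mdeg_eq0; apply/eqP/mnmP => i; rewrite mnm0E; apply/eqP.
have [//|mi] := eqVneq (m i) 0%N.
(* If [single_out i Q] is constant, [Q] equals its coefficient of index 0, whose monomials all have
   exponent 0 at [i], unlike [m]. *)
have := szQ i; rewrite -leqNgt => /size1_polyC FE.
have := horner_single_out i Q; rewrite FE hornerC coef_single_out.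
move=> /(congr1 (mcoeff m)) /eqP; rewrite eq_sym raddf_sum /= big1 => [|m' /eqP m'i].
  by rewrite mcoeff_eq0 mQ.
rewrite mulm0n subm0 mcoeffZ mcoeffX; case: eqP => [mm|_]; last by rewrite mulr0.
by rewrite -mm m'i in mi.
Qed.

End SingleOut.

(** * Leading coefficients and specialization at a fixed point *)

Section SemiconjStep.
Variables (F : fieldType) (k n : nat) (i : 'I_k).
Variables (P0 P : {poly F}) (Q : {mpoly F[k]}).
Hypotheses (n_gt1 : (1 < n)%N) (szP0 : size P0 = n.+1) (szP : size P = n.+1).
Hypothesis eqQ : subst_poly P0 Q = diag_subst P Q.
Hypothesis szQ : (1 < size (single_out i Q))%N.

Let mC := @mpolyC k F.
Let mC_inj : injective mC.
Proof. by move=> x y /eqP; rewrite mpolyC_eq => /eqP. Qed.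

Lemma single_out_semiconj :
  map_poly mC P0 \Po single_out i Q =
  map_poly (diag_subst P) (single_out i Q) \Po map_poly mC P.
Proof. by rewrite -single_out_subst eqQ single_out_diag. Qed.

Lemma semiconj_lead_coef :
  let d := (size (single_out i Q)).-1 in let q := lead_coef (single_out i Q) in
  lead_coef P0 *: q ^+ n = lead_coef P ^+ d *: diag_subst P q.
Proof.
move=> d q; set G := single_out i Q in d q *; have szG : (1 < size G)%N := szQ.
have szC (p : {poly F}) : size (map_poly mC p) = size p.
  exact: size_map_inj_poly.
have lcC (p : {poly F}) : lead_coef (map_poly mC p) = (lead_coef p)%:MP.
  exact: lead_coef_map_inj.
have eqG := single_out_semiconj; rewrite -/G in eqG.
(* [diag_subst P] might kill the leading coefficient of [G]; comparing degrees in [eqG] excludes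
   this. *)
have szsG : size (map_poly (diag_subst P) G) = size G.
  have := congr1 (fun p : {poly {mpoly F[k]}} => (size p).-1) eqG.
  rewrite !size_comp_poly !szC szP0 szP /= mulnC => /eqP.
  rewrite eqn_pmul2r ?(ltnW n_gt1) // => /eqP.
  by move: szG; case: (size G) => [|[|e]] //=; case: size => //= e' _ ->.
have := congr1 lead_coef eqG.
rewrite !lead_coef_comp ?szC ?szP ?ltnS ?(ltnW n_gt1) // !lcC szP0 szsG /=.
rewrite [lead_coef (map_poly (diag_subst P) G)]/lead_coef szsG coef_map.
by rewrite -/(lead_coef G) -/q mul_mpolyC mulrC -rmorphXn mul_mpolyC.
Qed.

Hypothesis charF : [pchar F] =i pred0.

Let nA0 : n%:R != 0 :> {mpoly F[k]}.
Proof.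
rewrite -mpolyC_nat mpolyC_eq0 ((pcharf0P F).1 charF); by move: n_gt1; clear; case: n.
Qed.

(** Since [P] fixes [z], evaluating coefficients at [(z, ..., z)] absorbs [diag_subst P]. The
    specialized [G] thus solves the same equation with the same leading coefficient [c], and
    uniqueness makes all coefficients of [G] constant. *)
Lemma semiconj_const_lead (z c : F) :
    P.[z] = z -> lead_coef (single_out i Q) = c%:MP ->
  univariate_in i Q.
Proof.
move=> Pz lcQ; set G := single_out i Q in lcQ.
pose ev : {rmorphism {mpoly F[k]} -> {mpoly F[k]}} := mC \o meval (fun=> z).
have evC (p : {poly F}) : map_poly ev (map_poly mC p) = map_poly mC p.
  by rewrite -map_poly_comp; apply: eq_map_poly => a /=; rewrite mevalC.
have ev_diag q : ev (diag_subst P q) = ev q.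
  apply: (mpoly_rmorph_ext (f := ev \o diag_subst P) (g := ev)) => [a|j] /=.
    by rewrite diag_substC.
  rewrite diag_substX; congr mC; rewrite rmorph_subst_poly /= mevalXU.
  by rewrite map_poly_id // => a _ /=; rewrite mevalC.
have diag_ev q : diag_subst P (ev q) = ev q by exact: diag_substC.
have c0 : c != 0.
  by rewrite -(mpolyC_eq0 k) -lcQ lead_coef_eq0 -size_poly_gt0 ltnW.
have evlc : ev (lead_coef G) = c%:MP by rewrite lcQ /= mevalC.
have evlc0 : ev (lead_coef G) != 0 by rewrite evlc mpolyC_eq0.
have szC (p : {poly F}) : size (map_poly mC p) = size p.
  exact: size_map_inj_poly.
have eqG := single_out_semiconj; rewrite -/G in eqG.
have GE : G = map_poly ev G.
  apply: (@semiconj_unique _ (diag_subst P) n (map_poly mC P0) (map_poly mC P)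
    G (map_poly ev G) n_gt1 nA0 _ _ szQ _ _ eqG).
  - by rewrite szC.
  - by rewrite szC.
  - by rewrite size_map_poly_id0.
  - by rewrite lead_coef_map_id0 ?rmorph0 // evlc lcQ.
  have := congr1 (map_poly ev) eqG; rewrite !map_comp_poly !evC => ->.
  congr (_ \Po _); rewrite -!map_poly_comp; apply: eq_map_poly => q.
  by rewrite [LHS]ev_diag [RHS]diag_ev.
exists (map_poly (meval (fun=> z)) G).
by rewrite /subst_poly -map_poly_comp -[map_poly _ _]GE horner_single_out.
Qed.

End SemiconjStep.

(** * Calculus of substitutions *)

Section SubstPoly.
Variables (F : fieldType) (k : nat).
Implicit Types (p r : {poly F}) (q : {mpoly F[k]}).

Lemma subst_polyZXn c n q : subst_poly (c *: 'X^n) q = c *: q ^+ n.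
Proof.
by rewrite /subst_poly map_polyZ map_polyXn hornerZ hornerXn mul_mpolyC.
Qed.

Lemma subst_poly_comp p r q :
  subst_poly (p \Po r) q = subst_poly p (subst_poly r q).
Proof. by rewrite /subst_poly map_comp_poly horner_comp. Qed.

Lemma subst_poly_aff (l : aff F) p q :
  subst_poly (aff_app l p) q = aff_app l (subst_poly p q).
Proof.
rewrite /aff_app /subst_poly rmorphD /= !map_polyZ rmorph1 hornerD !hornerZ.
by rewrite hornerC mulr1 mul_mpolyC alg_mpolyC.
Qed.

Lemma subst_polyX q : subst_poly 'X q = q.
Proof. by rewrite /subst_poly map_polyX hornerX. Qed.

Lemma comp_mpoly_subst (m : nat) (t : k.-tuple {mpoly F[m]}) p q :
  subst_poly p q \mPo t = subst_poly p (q \mPo t).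
Proof.
rewrite rmorph_subst_poly /subst_poly; congr _.[_].
by apply: eq_map_poly => c /=; rewrite comp_mpolyC.
Qed.

Lemma comp_mpoly_aff (m : nat) (t : k.-tuple {mpoly F[m]}) (l : aff F) q :
  aff_app l q \mPo t = aff_app l (q \mPo t).
Proof. by rewrite /aff_app comp_mpolyD !comp_mpolyZ comp_mpoly1. Qed.

Lemma subst_poly_inj (i : 'I_k) : injective (fun p => subst_poly p ('X_i : {mpoly F[k]})).
Proof.
(* Sending every variable to ['X] inverts the substitution of ['X_i] on the left. *)
pose e : {rmorphism {mpoly F[k]} -> {poly F}} := mmap (@polyC F) (fun=> 'X).
have eK p : e (subst_poly p 'X_i) = p.
  rewrite rmorph_subst_poly /= mmapX mmap1U -[RHS]comp_polyXr; congr _.[_].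
  by apply: eq_map_poly => c /=; rewrite mmapC.
by move=> p r /(congr1 e); rewrite !eK.
Qed.

End SubstPoly.

(** * The two descents on the degree *)

(** The outer [P0] is kept apart from [P] because the descent replaces it by [b *: 'X^n], while the
    inner polynomial remains [P]. *)
Lemma semiconj_dichotomy (F : closedFieldType) (k n : nat) (P : {poly F}) :
    [pchar F] =i pred0 -> (1 < n)%N -> size P = n.+1 ->
  forall (Q : {mpoly F[k]}) (P0 : {poly F}),
    size P0 = n.+1 -> subst_poly P0 Q = diag_subst P Q -> (1 < msize Q)%N ->
  (exists i, univariate_in i Q) \/
  (exists z, P = lead_coef P *: ('X - z%:P) ^+ n + z%:P).
Proof.
move=> charF n_gt1 szP Q; have [N] := ubnP (msize Q).
elim: N Q => // N IHN Q leN P0 szP0 eqQ Q1.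
have [i szG] := single_out_nonconst Q1.
have lcP : lead_coef P != 0 by rewrite lead_coef_eq0 -size_poly_gt0 szP.
have lcP0 : lead_coef P0 != 0 by rewrite lead_coef_eq0 -size_poly_gt0 szP0.
have /= := semiconj_lead_coef n_gt1 szP0 szP eqQ szG.
set d := (size _).-1; set q := lead_coef (single_out i Q) => eqq.
have lt_qQ : (msize q < msize Q)%N.
  by apply: msize_coef_single_out => //; move: szG; clear; rewrite -subn1 subn_gt0.
pose b := lead_coef P0 / lead_coef P ^+ d.
have b0 : b != 0 by rewrite mulf_neq0 // invr_eq0 expf_neq0.
have {}eqq : subst_poly (b *: 'X^n) q = diag_subst P q.
  by rewrite subst_polyZXn /b mulrC -scalerA eqq scalerA mulVf ?scale1r ?expf_neq0.
have [q1|q1] := leqP (msize q) 1.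
  left; exists i.
  (* A fixed point of [P] exists because [P - 'X] has degree [n > 1]. *)
  have /closed_rootP[z] : size (P - 'X) != 1%N.
    rewrite size_polyDl szP ?size_polyN ?size_polyX ?ltnS // eqSS.
    by move: n_gt1; clear; case: n.
  rewrite rootE !hornerE subr_eq0 => /eqP Pz.
  exact: (semiconj_const_lead n_gt1 szP0 szP eqQ szG charF Pz (msize1_polyC q1)).
have szb : size (b *: 'X^n : {poly F}) = n.+1 by rewrite size_scale ?size_polyXn.
have [|[j [f qf]]|] := IHN q _ _ szb eqq q1; last by right.
  exact: leq_trans lt_qQ _.
have szf : (1 < size f)%N.
  rewrite ltnNge; apply/negP => /size1_polyC fC; move: q1.
  by rewrite qf fC /subst_poly map_polyC hornerC msizeC; case: eqP.
(* With [q = f(x_j)], the equation for [q] involves [x_j] alone and becomes univariate. *)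
have eqf : b *: f ^+ n = f \Po P.
  apply: (@subst_poly_inj _ _ j); rewrite /= -comp_Xn_poly -comp_polyZ !subst_poly_comp.
  by rewrite -qf eqq qf /diag_subst comp_mpoly_subst -/(diag_subst P) diag_substX.
by have [z _ PE] := semiconj_power charF n_gt1 szP b0 szf eqf; right; exists z.
Qed.

(** For [P = 'X^n] the leading coefficient [q] satisfies the very same equation, so it is a monomial
    by induction; [q *: 'X^d] then competes with [G] in [semiconj_unique]. *)
Lemma power_commuting_monomial (F : fieldType) (k n : nat) :
    [pchar F] =i pred0 -> (1 < n)%N ->
  forall Q : {mpoly F[k]}, Q != 0 -> Q ^+ n = diag_subst 'X^n Q ->
  exists c (alpha : 'X_{1..k}), Q = c *: 'X_[alpha].
Proof.
move=> charF n_gt1 Q; have [N] := ubnP (msize Q).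
elim: N Q => // N IHN Q leN Q0 eqQ.
have [Q1|Q1] := leqP (msize Q) 1.
  by exists Q@_0, 0%MM; rewrite mpolyX0 alg_mpolyC; apply: msize1_polyC.
have [i szG] := single_out_nonconst Q1.
have szX : size ('X^n : {poly F}) = n.+1 by rewrite size_polyXn.
have eqQ' : subst_poly 'X^n Q = diag_subst 'X^n Q.
  by rewrite -eqQ -[in LHS](scale1r 'X^n) subst_polyZXn scale1r.
have /= := semiconj_lead_coef n_gt1 szX szX eqQ' szG.
set G := single_out i Q; set d := (size _).-1; set q := lead_coef G.
rewrite lead_coefXn expr1n !scale1r => eqq.
have lt_qQ : (msize q < msize Q)%N.
  by apply: msize_coef_single_out => //; move: szG; clear; rewrite -subn1 subn_gt0.
have q0 : q != 0 by rewrite lead_coef_eq0 -size_poly_gt0 ltnW.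
have [|c [alpha qE]] := IHN q _ q0 eqq; first exact: leq_trans lt_qQ _.
have GE : G = q *: 'X^d.
  have eqG := single_out_semiconj i eqQ'.
  apply: (@semiconj_unique _ (diag_subst 'X^n) n
    (map_poly (@mpolyC k F) 'X^n) (map_poly (@mpolyC k F) 'X^n)
    G (q *: 'X^d) n_gt1 _ _ _ szG _ _ eqG).
  - by rewrite -mpolyC_nat mpolyC_eq0 ((pcharf0P F).1 charF) -lt0n ltnW.
  - by rewrite map_polyXn size_polyXn.
  - by rewrite map_polyXn size_polyXn.
  - by rewrite size_scale // size_polyXn prednK // ltnW.
  - by rewrite lead_coefZ lead_coefXn mulr1.
  rewrite !map_polyXn map_polyZ map_polyXn /= -eqq comp_polyZ ?comp_Xn_poly.
  by rewrite exprZn -!exprM mulnC.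
exists c, (alpha + U_(i) *+ d)%MM.
rewrite -[LHS](horner_single_out i) -/G GE hornerZ hornerXn qE.
by rewrite -scalerAl mpolyXD mpolyXn.
Qed.

(** * Affine conjugation *)

Section Conjugation.
Variables (F : fieldType) (k : nat) (l : aff F).
Implicit Types (P : {poly F}) (Q : {mpoly F[k]}).

Lemma conj_mpolyE Q :
  conj_mpoly l Q = aff_app l (diag_subst (aff_app (aff_inv l) 'X) Q).
Proof.
rewrite /conj_mpoly /diag_subst; congr (aff_app l (_ \mPo _)).
by apply: eq_mktuple => i; rewrite subst_poly_aff subst_polyX.
Qed.

Lemma diag_subst_comp (p r : {poly F}) Q :
  diag_subst p (diag_subst r Q) = diag_subst (r \Po p) Q.
Proof.
apply: (mpoly_rmorph_ext (f := diag_subst p \o diag_subst r)) => [c|i] /=.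
  by rewrite !diag_substC.
rewrite !diag_substX {1}/diag_subst comp_mpoly_subst -/(diag_subst p).
by rewrite diag_substX subst_poly_comp.
Qed.

Lemma aff_app_comp (p q : {poly F}) (m : aff F) :
  aff_app m p \Po q = aff_app m (p \Po q).
Proof.
by rewrite /aff_app comp_polyD !comp_polyZ -(polyC1 F) comp_polyC.
Qed.

Lemma diag_subst_id Q : diag_subst 'X Q = Q.
Proof.
apply: (mpoly_rmorph_ext (f := diag_subst 'X) (g := idfun)) => [c|i] /=.
  by rewrite diag_substC.
by rewrite diag_substX subst_polyX.
Qed.

(** The inner [l] and [aff_inv l] cancel: with [p] the inverse of [l], both sides are [l] applied to
    [Q(P(p(x_1)), ..., P(p(x_k)))]. *)
Lemma conj_commute P Q :
    subst_poly P Q = diag_subst P Q ->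
  subst_poly (conj_poly l P) (conj_mpoly l Q) =
  diag_subst (conj_poly l P) (conj_mpoly l Q).
Proof.
move=> PQ; rewrite conj_mpolyE; set p := aff_app (aff_inv l) 'X.
rewrite {1}/conj_poly subst_poly_aff subst_poly_comp subst_poly_aff subst_polyX.
rewrite aff_appK -/p.
rewrite /diag_subst comp_mpoly_aff -!/(diag_subst _) diag_subst_comp.
rewrite -comp_mpoly_subst PQ -/(diag_subst p _) diag_subst_comp; congr aff_app.
by rewrite aff_app_comp comp_polyX /conj_poly aff_appK.
Qed.

(** Undoing the conjugation shows that a nonconstant [Q] keeps a nonconstant conjugate, whence the
    nonzero exponent in the theorem. *)
Lemma conj_mpoly_const Q c : conj_mpoly l Q = c%:MP -> exists a, Q = a%:MP.
Proof.
rewrite conj_mpolyE; set p := aff_app (aff_inv l) 'X.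
move=> /(congr1 (fun q => aff_app (aff_inv l) q)); rewrite aff_appK => Qc.
exists (aff_slope (aff_inv l) * c + aff_shift (aff_inv l)).
have <- : diag_subst (aff_app l 'X) (diag_subst p Q) = Q.
  by rewrite diag_subst_comp aff_app_comp comp_polyX aff_appK diag_subst_id.
rewrite Qc /aff_app -mul_mpolyC alg_mpolyC -mpolyCM -mpolyCD.
exact: diag_substC.
Qed.

(** Here [l] is [s (x - z)]: it moves the centre [z] to 0, and [s^n = a s] turns the leading
    coefficient into 1. *)
Lemma conj_poly_center (n : nat) (a z : F) :
    aff_slope l ^+ n = a * aff_slope l -> aff_shift l = - (aff_slope l * z) ->
  conj_poly l (a *: ('X - z%:P) ^+ n + z%:P) = 'X^n.
Proof.
case: l => s t s0 /= sa ->.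
rewrite /conj_poly /aff_app /= mulrN mulKf // opprK.
rewrite comp_polyD comp_polyZ -comp_Xn_poly -comp_polyA.
rewrite comp_polyB comp_polyX !comp_polyC !alg_polyC addrK comp_Xn_poly exprZn.
rewrite scalerDr !scalerA -[s *: z%:P]mul_polyC -polyCM polyCN addrK.
rewrite [s * a]mulrC -sa -exprMn mulfV // expr1n scale1r //.
Qed.

End Conjugation.

(** * Normalization of [P] and of the constant [c] *)

Theorem theorem1p2 (R : realType) (nu n : nat)
    (P : {poly R[i]}) (Q : {mpoly R[i][nu]})
    (nu_ge2 : (2 <= nu)%N)
    (degP : size P = n.+1) (n_gt1 : (1 < n)%N)
    (degQ : (1 <= (msize Q).-1)%N)
    (PQ_comm : subst_poly P Q = Q \mPo [tuple subst_poly P 'X_i | i < nu])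
    (Q_multi : forall i : 'I_nu, ~ univariate_in i Q) :
  exists (l : aff R[i]) (c : R[i]) (alpha : 'X_{1..nu}),
    [/\ alpha != 0%MM,
        conj_poly l P = 'X^n,
        conj_mpoly l Q = c *: 'X_[alpha]
      & c ^+ (n - 1) = 1].
Proof.
have charC : [pchar R[i]] =i pred0 by exact: Num.Theory.pchar_num.
have Q1 : (1 < msize Q)%N by move: degQ; clear; rewrite -subn1 subn_gt0.
have [[i /Q_multi //]|[z PE]] :=
  semiconj_dichotomy charC n_gt1 degP degP PQ_comm Q1.
set a := lead_coef P in PE.
have a0 : a != 0 by rewrite lead_coef_eq0 -size_poly_gt0 degP.
have n1_gt0 : (0 < n.-1)%N by move: n_gt1; clear; case: n => [|[]].
(* The slope is an [(n - 1)]-th root of [a], as [conj_poly_center] requires. *)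
have [s /eqP] : exists s : R[i], root ('X^(n.-1) - a%:P) s.
  by apply/closed_rootP; rewrite size_XnsubC // eqSS -lt0n.
rewrite hornerD hornerN hornerXn hornerC => /eqP; rewrite subr_eq0 => /eqP sa.
have s0 : s != 0 by apply: contraNneq a0 => s0; rewrite -sa s0 expr0n gtn_eqF.
pose l := @Aff _ s (- (s * z)) s0.
have PX : conj_poly l P = 'X^n.
  rewrite PE conj_poly_center //= -sa -exprSr prednK //; exact: ltnW.
have Qnc c : conj_mpoly l Q <> c%:MP.
  by move=> /conj_mpoly_const[b Qb]; move: Q1; rewrite Qb msizeC; case: eqP.
have eqQ := conj_commute l PQ_comm.
rewrite PX -[in LHS](scale1r 'X^n) subst_polyZXn scale1r in eqQ.
have Q0 : conj_mpoly l Q != 0 by apply/eqP => Q0; apply: (Qnc 0); rewrite Q0 mpolyC0.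
have [c [alpha QE]] := power_commuting_monomial charC n_gt1 Q0 eqQ.
exists l, c, alpha; split=> //.
  by apply: contra_notN (Qnc c) => /eqP al0; rewrite QE al0 mpolyX0 alg_mpolyC.
have c0 : c != 0 by apply: contraNneq Q0 => c0; rewrite QE c0 scale0r.
move: eqQ; rewrite QE /diag_subst comp_mpolyZ comp_mpolyX.
have -> : \prod_(i < nu) tnth [tuple subst_poly 'X^n 'X_i | i < nu] i ^+ alpha i =
    'X_[alpha] ^+ n :> {mpoly R[i][nu]}.
  rewrite mpolyXE_id -prodrXl; apply: eq_bigr => i _.
  by rewrite tnth_mktuple -[X in subst_poly X]scale1r subst_polyZXn scale1r exprAC.
(* The coefficients of the monomial with exponent [alpha *+ n] on the two sides give [c^n = c]. *)
rewrite exprZn mpolyXn => /(congr1 (mcoeff (alpha *+ n))).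
rewrite !mcoeffZ mcoeffX eqxx !mulr1 subn1 => cn.
by apply: (mulIf c0); rewrite mul1r -exprSr prednK // ltnW.
Qed.
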